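(* Let $a,b,c$ be positive real numbers with $a\neq b$, $k$ a nonnegative integer, $r$ a positive integer, and $\overline{\alpha}_r=(\alpha_0,\dots,\alpha_{r-1})$ nonzero complex numbers; write $\frac{1}{\overline{\alpha}_r}=(\frac{1}{\alpha_0},\dots,\frac{1}{\alpha_{r-1}})$. Then for all real $x$ and $n\in\mathbb{N}_0$, $$M^{[0,r]}_{n}(r-x;k;a,b,c;\overline{\alpha}_{r})=\frac{(-1)^{r(1-k)+n}}{\prod_{i=0}^{r-1}\alpha_{i}}\sum_{j=0}^{n}\binom{n}{j}\left(r\ln\left(\frac{ab}{c}\right)\right)^{n-j}M^{[0,r]}_{j}\left(x;k;a,b,c;\frac{1}{\overline{\alpha}_{r}}\right).$$
   Context: For positive reals $a,b,c$ with $a\neq b$, a nonnegative integer $k$, a positive integer $r$ and complex numbers $\overline{\beta}_r=(\beta_0,\dots,\beta_{r-1})$, the polynomials $M^{[0,r]}_{n}(x;k;a,b,c;\overline{\beta}_{r})$, $n\in\mathbb{N}_0$, are defined as the Taylor coefficients at $t=0$ of $$\frac{t^{rk}2^{r(1-k)}c^{xt}}{\prod_{i=0}^{r-1}\left(\beta_{i}b^{t}-a^{t}\right)}=\sum_{n=0}^{\infty}M^{[0,r]}_{n}(x;k;a,b,c;\overline{\beta}_{r})\frac{t^{n}}{n!},$$ the parameters being assumed such that the generating functions involved are analytic in a neighbourhood of $t=0$. $\ln$ is the natural logarithm. *)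

(* Defs.v *)
From Stdlib Require Import Reals Factorial ClassicalEpsilon.
From Coquelicot Require Import Coquelicot.

Open Scope R_scope.

Definition Cexp (z : C) : C := (exp (Re z) * cos (Im z), exp (Re z) * sin (Im z)).

(* [a^z] for a real [a > 0], by the real logarithm of [a]. *)
Definition Rcpow (a : R) (z : C) : C := Cexp (RtoC (ln a) * z)%C.

Fixpoint Cprod (f : nat -> C) (r : nat) : C :=
  match r with
  | O => RtoC 1
  | S m => (Cprod f m * f m)%C
  end.

(* [f(t) = sum_n M_n t^n / n!] near [0].  The point [t = 0] itself is left out,
   because the quotients considered below may have a removable singularity
   there, where the total division of [C] returns an irrelevant value; such an
   [f] is understood as its analytic continuation to [0].  At most one [M]
   satisfies this predicate. *)
Definition is_Taylor0 (f : C -> C) (M : nat -> C) : Prop :=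
  exists rho : R, 0 < rho /\
    forall t : C, 0 < Cmod t < rho ->
      is_pseries (K := C_AbsRing) (V := C_NormedModule)
        (fun n : nat => (M n / RtoC (INR (fact n)))%C) t (f t).

Definition analytic_at_0 (f : C -> C) : Prop :=
  exists M : nat -> C, is_Taylor0 f M.

(* The coefficients [M] of [is_Taylor0] when [f] is analytic at [0];
   unspecified otherwise. *)
Definition Taylor0 (f : C -> C) : nat -> C :=
  epsilon (inhabits (fun _ : nat => RtoC 0)) (is_Taylor0 f).

(* Only [beta 0, ..., beta (r - 1)] are used.  The exponent [r (1 - k)] is an
   integer, possibly negative. *)
Definition gen_fun (x : R) (k : nat) (a b c : R) (r : nat) (beta : nat -> C)
    (t : C) : C :=
  (t ^ (r * k)
   * RtoC (powerRZ 2 (Z.of_nat r * (1 - Z.of_nat k)))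
   * Rcpow c (RtoC x * t)
   / Cprod (fun i : nat => beta i * Rcpow b t - Rcpow a t) r)%C.

Definition Mpoly (r n : nat) (x : R) (k : nat) (a b c : R) (beta : nat -> C) : C :=
  Taylor0 (gen_fun x k a b c r beta) n.

(* Main.v *)
(* Since [alpha b^t - a^t = - alpha (ab)^t (alpha^-1 b^(-t) - a^(-t))], the
   generating function at [(r - x, alpha, t)] is a constant times
   [exp (- r ln (ab/c) t)] times the one at [(x, 1/alpha, - t)]; the claim is the
   comparison of Taylor coefficients.  Coefficients are determined by the values
   at real [t], so the Cauchy product and the uniqueness of coefficients are only
   needed for real power series, applied to real and imaginary parts. *)
Require Import Defs.
From Stdlib Require Import Reals.
From Coquelicot Require Import Coquelicot.
From Stdlib Require Import Factorial Lra Lia ClassicalEpsilon.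

Open Scope R_scope.

(** * Complex power series at real points: real and imaginary parts *)

Lemma Taylor0_spec (f : C -> C) : analytic_at_0 f -> is_Taylor0 f (Taylor0 f).
Proof. exact (epsilon_spec _ _). Qed.

Lemma pow_n_RtoC (t : R) (n : nat) :
  pow_n (K := C_AbsRing) (RtoC t) n = RtoC (t ^ n).
Proof.
  induction n as [|n IH]; [reflexivity|].
  change (RtoC t * pow_n (K := C_AbsRing) (RtoC t) n = RtoC (t * t ^ n))%C.
  now rewrite IH, RtoC_mult.
Qed.

Lemma pow_n_R (t : R) (n : nat) : pow_n (K := R_AbsRing) t n = t ^ n.
Proof. exact (pow_n_pow t n). Qed.

Lemma Re_sum_n (u : nat -> C) (n : nat) :
  Re (sum_n (G := C_AbelianMonoid) u n) = sum_n (fun j => Re (u j)) n.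
Proof.
  induction n as [|n IH]; [now rewrite !sum_O|].
  rewrite !sum_Sn, <- IH. reflexivity.
Qed.

Lemma Im_sum_n (u : nat -> C) (n : nat) :
  Im (sum_n (G := C_AbelianMonoid) u n) = sum_n (fun j => Im (u j)) n.
Proof.
  induction n as [|n IH]; [now rewrite !sum_O|].
  rewrite !sum_Sn, <- IH. reflexivity.
Qed.

(** The powers of a real [t] are real, so taking real parts commutes with each term; balls of [C]
    are products of real balls, so convergence passes to components. *)
Lemma is_pseries_Re (u : nat -> C) (t : R) (l : C) :
  is_pseries (K := C_AbsRing) (V := C_NormedModule) u (RtoC t) l ->
  is_pseries (fun n => Re (u n)) t (Re l).
Proof.
  intros H. apply filterlim_locally. intros eps.
  generalize (proj1 (filterlim_locally _ _) H eps). apply filter_imp.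
  intros n [Hn _]. revert Hn.
  match goal with |- ball _ _ (fst ?s) -> _ => change (fst s) with (Re s) end.
  rewrite Re_sum_n. intros Hn.
  rewrite (sum_n_ext _ (fun j => Re (scal (pow_n (K := C_AbsRing) (RtoC t) j) (u j)))).
  - exact Hn.
  - intros j. rewrite pow_n_R, pow_n_RtoC. symmetry. exact (re_scal_l _ _).
Qed.

Lemma is_pseries_Im (u : nat -> C) (t : R) (l : C) :
  is_pseries (K := C_AbsRing) (V := C_NormedModule) u (RtoC t) l ->
  is_pseries (fun n => Im (u n)) t (Im l).
Proof.
  intros H. apply filterlim_locally. intros eps.
  generalize (proj1 (filterlim_locally _ _) H eps). apply filter_imp.
  intros n [_ Hn]. revert Hn.
  match goal with |- ball _ _ (snd ?s) -> _ => change (snd s) with (Im s) end.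
  rewrite Im_sum_n. intros Hn.
  rewrite (sum_n_ext _ (fun j => Im (scal (pow_n (K := C_AbsRing) (RtoC t) j) (u j)))).
  - exact Hn.
  - intros j. rewrite pow_n_R, pow_n_RtoC. symmetry. exact (im_scal_l _ _).
Qed.

(** * Radius of convergence and uniqueness of real coefficients *)

Lemma CV_radius_ge_of_ex_pseries (a : nat -> R) (t : R) :
  ex_pseries a t -> Rbar_le (Rabs t) (CV_radius a).
Proof.
  intros H. apply Rbar_not_lt_le. intros Hlt.
  apply (CV_disk_outside _ _ Hlt).
  apply ex_series_lim_0. revert H. apply ex_series_ext. intros n.
  rewrite pow_n_R. apply Rmult_comm.
Qed.

(** The series converges at the midpoint of [t] and [rho], which is nonzero even when [t = 0]; this
    makes the inequality strict. *)
Lemma CV_radius_ge_of_punctured (a : nat -> R) (rho : R) (f : R -> R) :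
  (forall t, 0 < Rabs t < rho -> is_pseries a t (f t)) ->
  forall t, 0 <= t < rho -> Rbar_lt t (CV_radius a).
Proof.
  intros H t Ht.
  apply Rbar_lt_le_trans with ((t + rho) / 2); [simpl; lra|].
  assert (Ha : Rabs ((t + rho) / 2) = (t + rho) / 2) by (apply Rabs_pos_eq; lra).
  rewrite <- Ha. apply CV_radius_ge_of_ex_pseries.
  eexists. apply H. rewrite Ha. lra.
Qed.

(* Multiplying both series by [t] extends the equality of the sums to [t = 0]. *)
Lemma pseries_coeff_unique (a b : nat -> R) (rho : R) (f : R -> R) :
  0 < rho ->
  (forall t, 0 < Rabs t < rho -> is_pseries a t (f t)) ->
  (forall t, 0 < Rabs t < rho -> is_pseries b t (f t)) ->
  forall n, a n = b n.
Proof.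
  intros Hrho Ha Hb n.
  change (PS_incr_1 a (S n) = PS_incr_1 b (S n)).
  apply PSeries_ext_recip.
  - rewrite CV_radius_incr_1. apply (CV_radius_ge_of_punctured a rho f Ha). lra.
  - rewrite CV_radius_incr_1. apply (CV_radius_ge_of_punctured b rho f Hb). lra.
  - exists (mkposreal rho Hrho). intros t Ht.
    change (Rabs (t - 0) < rho) in Ht. rewrite Rminus_0_r in Ht.
    rewrite !PSeries_incr_1.
    destruct (Req_dec t 0) as [->|Ht0]; [ring|].
    assert (Hp := Rabs_pos_lt t Ht0).
    rewrite (is_pseries_unique _ _ _ (Ha t (conj Hp Ht))).
    now rewrite (is_pseries_unique _ _ _ (Hb t (conj Hp Ht))).
Qed.

(** * Product of a reflected real series with an exponential *)

Lemma is_pseries_exp_scal (lambda t : R) :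
  is_pseries (fun n => lambda ^ n / INR (fact n)) t (exp (lambda * t)).
Proof.
  generalize (is_exp_Reals (lambda * t)). apply is_series_ext. intros n.
  rewrite !pow_n_R, Rpow_mult_distr.
  change (lambda ^ n * t ^ n * / INR (fact n) = t ^ n * (lambda ^ n / INR (fact n))).
  unfold Rdiv. ring.
Qed.

Lemma is_pseries_reflect (a : nat -> R) (t l : R) :
  is_pseries a (- t) l -> is_pseries (fun n => (-1) ^ n * a n) t l.
Proof.
  apply is_series_ext. intros n. rewrite !pow_n_R.
  replace (- t) with (-1 * t) by ring. rewrite Rpow_mult_distr.
  change ((-1) ^ n * t ^ n * a n = t ^ n * ((-1) ^ n * a n)). ring.
Qed.

Lemma coeff_exp_mult_reflect (u v : nat -> R) (F G : R -> R) (rho K lambda : R) :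
  0 < rho ->
  (forall t, 0 < Rabs t < rho -> is_pseries u t (F t)) ->
  (forall t, 0 < Rabs t < rho -> is_pseries v t (G t)) ->
  (forall t, F t = K * exp (lambda * t) * G (- t)) ->
  forall n, u n =
    K * sum_n (fun j => (-1) ^ j * v j * (lambda ^ (n - j) / INR (fact (n - j)))) n.
Proof.
  intros Hrho Hu Hv HFG n. rewrite sum_n_Reals.
  set (v' := fun j => (-1) ^ j * v j).
  set (e := fun j => lambda ^ j / INR (fact j)).
  (* The claimed sum is by conversion a coefficient of a scaled Cauchy product, so uniqueness
     reduces the goal to an equality of sums for [t] near 0. *)
  change (u n = PS_scal K (PS_mult v' e) n).
  revert n. apply (pseries_coeff_unique _ _ rho F Hrho Hu).
  assert (Hv' : forall t, 0 < Rabs t < rho -> is_pseries v' t (G (- t))).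
  { intros t Ht. apply is_pseries_reflect, Hv. now rewrite Rabs_Ropp. }
  assert (He : forall t, 0 < Rabs t < rho -> is_pseries e t (exp (lambda * t))).
  { intros t _. apply is_pseries_exp_scal. }
  intros t Ht. rewrite HFG.
  replace (K * exp (lambda * t) * G (- t)) with (scal K (G (- t) * exp (lambda * t)))
    by (change (K * (G (- t) * exp (lambda * t)) = K * exp (lambda * t) * G (- t)); ring).
  apply (is_pseries_scal (K := R_AbsRing) (V := R_NormedModule)); [apply Rmult_comm|].
  apply is_pseries_mult.
  - now apply Hv'.
  - apply is_pseries_exp_scal.
  - apply (CV_radius_ge_of_punctured _ rho _ Hv'). lra.
  - apply (CV_radius_ge_of_punctured _ (rho) _ He). lra.
Qed.

(** * Reflection of the generating function at real [t] *)

(* Holds at [0] too, since [/ 0 = 0] in [C]. *)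
Lemma Cinv_mult (x y : C) : (/ (x * y) = / x * / y)%C.
Proof.
  assert (H0 : (/ RtoC 0)%C = RtoC 0).
  { unfold Cinv, RtoC; simpl. f_equal; unfold Rdiv; ring. }
  destruct (Ceq_dec x 0) as [->|Hx]; [now rewrite Cmult_0_l, H0, Cmult_0_l|].
  destruct (Ceq_dec y 0) as [->|Hy]; [now rewrite Cmult_0_r, H0, Cmult_0_r|].
  field. now split.
Qed.

Lemma Rcpow_RtoC (a t : R) : Rcpow a (RtoC t) = RtoC (exp (ln a * t)).
Proof.
  unfold Rcpow, Cexp. rewrite <- RtoC_mult.
  change (Re (RtoC (ln a * t))) with (ln a * t).
  change (Im (RtoC (ln a * t))) with 0.
  rewrite cos_0, sin_0. unfold RtoC. f_equal; ring.
Qed.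

Lemma Cprod_neq_0 (f : nat -> C) (r : nat) :
  (forall i, (i < r)%nat -> f i <> RtoC 0) -> Cprod f r <> RtoC 0.
Proof.
  induction r as [|r IH]; intros H; simpl.
  - intros E. apply RtoC_inj in E. lra.
  - apply Cmult_neq_0; [apply IH; intros i Hi|]; apply H; lia.
Qed.

Lemma Cprod_denominator_reflect (a b : R) (alpha : nat -> C) (t : R) (r : nat) :
  0 < a -> 0 < b ->
  (forall i, (i < r)%nat -> alpha i <> RtoC 0) ->
  (Cprod (fun i => alpha i * Rcpow b (RtoC t) - Rcpow a (RtoC t)) r
   = RtoC ((-1) ^ r * exp (INR r * ln (a * b) * t)) * Cprod alpha r
     * Cprod (fun i => / alpha i * Rcpow b (RtoC (- t)) - Rcpow a (RtoC (- t))) r)%C.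
Proof.
  intros Ha Hb. rewrite !Rcpow_RtoC, ln_mult by assumption.
  induction r as [|r IH]; intros H.
  - simpl. rewrite Rmult_0_l, Rmult_0_l, exp_0, Rmult_1_l. ring.
  - cbn [Cprod]. rewrite IH by (intros i Hi; apply H; lia).
    assert (Hr := H r (Nat.lt_succ_diag_r r)).
    rewrite S_INR.
    replace ((INR r + 1) * (ln a + ln b) * t)
      with (INR r * (ln a + ln b) * t + (ln a * t + ln b * t)) by ring.
    rewrite !exp_plus. cbn [pow].
    (* With exponentials at [- t] written as inverses, the identity for a single factor is rational
       in [alpha r], [a^t] and [b^t]. *)
    replace (ln a * - t) with (- (ln a * t)) by ring.
    replace (ln b * - t) with (- (ln b * t)) by ring.
    rewrite !exp_Ropp, !RtoC_mult, !RtoC_inv by apply Rgt_not_eq, exp_pos.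
    assert (HA : RtoC (exp (ln a * t)) <> 0).
    { intros E. apply RtoC_inj in E. generalize (exp_pos (ln a * t)). lra. }
    assert (HB : RtoC (exp (ln b * t)) <> 0).
    { intros E. apply RtoC_inj in E. generalize (exp_pos (ln b * t)). lra. }
    field. now repeat split.
Qed.

(** The sign [(-1) ^ (r * k)] comes from [t ^ (r * k)] and [(-1) ^ r] from the denominator. The
    factor [c^(r t)] of [c^((r - x) t)] joins [(ab)^(- r t)] to form the exponential. *)
Lemma gen_fun_reflect (a b c : R) (k r : nat) (alpha : nat -> C) (x t : R) :
  0 < a -> 0 < b -> 0 < c ->
  (forall i, (i < r)%nat -> alpha i <> RtoC 0) ->
  (Cprod alpha r * gen_fun (INR r - x) k a b c r alpha (RtoC t)
   = RtoC ((-1) ^ (r * k) * (-1) ^ r * exp (- (INR r * ln (a * b / c)) * t))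
     * gen_fun x k a b c r (fun i => / alpha i) (RtoC (- t)))%C.
Proof.
  intros Ha Hb Hc H. unfold gen_fun, Cdiv.
  rewrite Cprod_denominator_reflect, !Cinv_mult by assumption.
  rewrite <- !RtoC_mult, !Rcpow_RtoC, <- !RtoC_pow.
  replace (- t) with (-1 * t) at 1 by ring. rewrite Rpow_mult_distr.
  assert (HP := Cprod_neq_0 alpha r H).
  (* This inverse is common to both sides; kept opaque, it covers a vanishing denominator as
     well. *)
  set (D := (/ Cprod (fun i => / alpha i * _ - _) r)%C).
  assert (Hs : (-1) ^ r * (-1) ^ r = 1).
  { rewrite <- Rpow_mult_distr. replace (-1 * -1) with 1 by ring. apply pow1. }
  (* On the right this sign occurs twice, in the prefactor and in [(- t) ^ (r * k)]. *)
  assert (Hk : (-1) ^ (r * k) * (-1) ^ (r * k) = 1).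
  { rewrite <- Rpow_mult_distr. replace (-1 * -1) with 1 by ring. apply pow1. }
  rewrite <- RtoC_inv
    by (apply Rmult_integral_contrapositive; split;
        [apply pow_nonzero; lra | apply Rgt_not_eq, exp_pos]).
  rewrite Rinv_mult, <- exp_Ropp.
  replace (/ (-1) ^ r) with ((-1) ^ r)
    by (apply (Rmult_eq_reg_l ((-1) ^ r)); [|apply pow_nonzero; lra];
        rewrite Hs, Rinv_r; [reflexivity | apply pow_nonzero; lra]).
  rewrite ln_div by nra.
  replace (exp (ln c * ((INR r - x) * t)))
    with (exp (INR r * ln c * t) * exp (- (ln c * (x * t))))
    by (rewrite <- exp_plus; f_equal; ring).
  replace (exp (- (INR r * (ln (a * b) - ln c)) * t))
    with (exp (- (INR r * ln (a * b) * t)) * exp (INR r * ln c * t))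
    by (rewrite <- exp_plus; f_equal; ring).
  replace (exp (ln c * (x * - t))) with (exp (- (ln c * (x * t)))) by (f_equal; ring).
  transitivity (RtoC (((-1) ^ (r * k) * (-1) ^ (r * k))
     * (t ^ (r * k) * powerRZ 2 (Z.of_nat r * (1 - Z.of_nat k))
        * (exp (INR r * ln c * t) * exp (- (ln c * (x * t))))
        * ((-1) ^ r * exp (- (INR r * ln (a * b) * t))))) * D)%C.
  - rewrite Hk, !RtoC_mult. field. exact HP.
  - rewrite !RtoC_mult. ring.
Qed.

(** * Comparison of complex Taylor coefficients *)

Lemma powerRZ_m1_sub (r k : nat) :
  powerRZ (-1) (Z.of_nat r * (1 - Z.of_nat k)) = (-1) ^ (r * k) * (-1) ^ r.
Proof.
  replace (Z.of_nat r * (1 - Z.of_nat k))%Z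
    with (Z.of_nat r + - Z.of_nat (r * k))%Z by lia.
  rewrite powerRZ_add, powerRZ_neg', <- !pow_powerRZ by lra.
  rewrite <- pow_inv. replace (/ -1) with (-1) by lra. ring.
Qed.

(** The sign [(-1) ^ j] of the reflection and the sign [(-1) ^ (n - j)] inside [(- mu) ^ (n - j)]
    combine to [(-1) ^ n]; the factorials form the binomial coefficient. *)
Lemma binomial_coeff_reflect (v : nat -> R) (mu : R) (n : nat) :
  INR (fact n) *
    sum_n (fun j => (-1) ^ j * (v j / INR (fact j))
                    * ((- mu) ^ (n - j) / INR (fact (n - j)))) n
  = (-1) ^ n * sum_n (fun j => Binomial.C n j * mu ^ (n - j) * v j) n.
Proof.
  rewrite !sum_n_Reals, !scal_sum. apply sum_eq. intros j Hj.
  replace (- mu) with (-1 * mu) by ring. rewrite Rpow_mult_distr.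
  replace ((-1) ^ n) with ((-1) ^ j * (-1) ^ (n - j))
    by (rewrite <- pow_add; f_equal; lia).
  unfold Binomial.C. field. split; apply INR_fact_neq_0.
Qed.

Lemma is_Taylor0_real (f : C -> C) (M : nat -> C) :
  is_Taylor0 f M ->
  exists rho, 0 < rho /\ forall t : R, 0 < Rabs t < rho ->
    is_pseries (K := C_AbsRing) (V := C_NormedModule)
      (fun n => M n / RtoC (INR (fact n)))%C (RtoC t) (f (RtoC t)).
Proof.
  intros [rho [Hrho H]]. exists rho. split; [exact Hrho|].
  intros t Ht. apply H. now rewrite Cmod_R.
Qed.

(** Lets the complex constant [Cprod alpha r] be absorbed into the function, so that the factor [K]
    in the comparison of coefficients is real. *)
Lemma is_Taylor0_scal (f : C -> C) (M : nat -> C) (z : C) :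
  is_Taylor0 f M -> is_Taylor0 (fun t => z * f t)%C (fun n => z * M n)%C.
Proof.
  intros [rho [Hrho H]]. exists rho. split; [exact Hrho|].
  intros t Ht.
  apply (is_series_ext (K := C_AbsRing) (V := C_NormedModule)
    (fun n => scal (pow_n (K := C_AbsRing) t n)
                (scal z (M n / RtoC (INR (fact n)))%C))).
  - intros n. unfold scal; simpl. unfold mult; simpl. unfold Cdiv. ring.
  - apply (is_pseries_scal (K := C_AbsRing) (V := C_NormedModule) z _ t).
    + exact (Cmult_comm _ _).
    + now apply H.
Qed.

Lemma Re_div_R (z : C) (s : R) : s <> 0 -> Re (z / RtoC s)%C = Re z / s.
Proof. intros Hs. unfold Cdiv. rewrite <- RtoC_inv by exact Hs. apply re_scal_r. Qed.

Lemma Im_div_R (z : C) (s : R) : s <> 0 -> Im (z / RtoC s)%C = Im z / s.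
Proof. intros Hs. unfold Cdiv. rewrite <- RtoC_inv by exact Hs. apply im_scal_r. Qed.

(** Since [K * exp (- mu * t)] is real, the relation between [F] and [G] splits into the same real
    relation for real and for imaginary parts. *)
Lemma Taylor_coeff_exp_mult_reflect (F G : C -> C) (N M : nat -> C) (K mu : R) :
  is_Taylor0 F N -> is_Taylor0 G M ->
  (forall t : R, F (RtoC t) = RtoC (K * exp (- mu * t)) * G (RtoC (- t)))%C ->
  forall n, N n =
    (RtoC (K * (-1) ^ n)
     * sum_n (G := C_AbelianMonoid)
         (fun j => RtoC (Binomial.C n j * mu ^ (n - j)) * M j) n)%C.
Proof.
  intros HF HG HFG n.
  destruct (is_Taylor0_real _ _ HF) as [r1 [Hr1 H1]].
  destruct (is_Taylor0_real _ _ HG) as [r2 [Hr2 H2]].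
  assert (Hrho : 0 < Rmin r1 r2) by now apply Rmin_pos.
  assert (Hl := Rmin_l r1 r2). assert (Hr := Rmin_r r1 r2).
  assert (Hfact := INR_fact_neq_0).
  assert (HRe : Re (N n) / INR (fact n) = K * sum_n (fun j =>
    (-1) ^ j * (Re (M j) / INR (fact j)) * ((- mu) ^ (n - j) / INR (fact (n - j)))) n).
  { apply (coeff_exp_mult_reflect (fun n => Re (N n) / INR (fact n))
      (fun n => Re (M n) / INR (fact n))
      (fun t => Re (F (RtoC t))) (fun t => Re (G (RtoC t))) (Rmin r1 r2)).
    - exact Hrho.
    - intros t Ht. eapply is_series_ext; [|apply is_pseries_Re, H1; lra].
      intros j. cbv beta. now rewrite Re_div_R.
    - intros t Ht. eapply is_series_ext; [|apply is_pseries_Re, H2; lra].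
      intros j. cbv beta. now rewrite Re_div_R.
    - intros t. rewrite HFG. apply re_scal_l. }
  assert (HIm : Im (N n) / INR (fact n) = K * sum_n (fun j =>
    (-1) ^ j * (Im (M j) / INR (fact j)) * ((- mu) ^ (n - j) / INR (fact (n - j)))) n).
  { apply (coeff_exp_mult_reflect (fun n => Im (N n) / INR (fact n))
      (fun n => Im (M n) / INR (fact n))
      (fun t => Im (F (RtoC t))) (fun t => Im (G (RtoC t))) (Rmin r1 r2)).
    - exact Hrho.
    - intros t Ht. eapply is_series_ext; [|apply is_pseries_Im, H1; lra].
      intros j. cbv beta. now rewrite Im_div_R.
    - intros t Ht. eapply is_series_ext; [|apply is_pseries_Im, H2; lra].
      intros j. cbv beta. now rewrite Im_div_R.
    - intros t. rewrite HFG. apply im_scal_l. }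
  (* Multiplying by [n!] brings both identities to the form treated by [binomial_coeff_reflect]. *)
  assert (Hc : forall y s : R, y / INR (fact n) = K * s -> y = K * (INR (fact n) * s)).
  { intros y s E. replace y with (y / INR (fact n) * INR (fact n)) by now field.
    rewrite E. ring. }
  apply Hc in HRe, HIm. rewrite binomial_coeff_reflect in HRe, HIm.
  apply injective_projections.
  - match goal with |- _ = fst ?z => change (Re (N n) = Re z) end.
    rewrite HRe, re_scal_l, Re_sum_n, Rmult_assoc. do 2 f_equal.
    apply sum_n_ext. intros j. now rewrite re_scal_l.
  - match goal with |- _ = snd ?z => change (Im (N n) = Im z) end.
    rewrite HIm, im_scal_l, Im_sum_n, Rmult_assoc. do 2 f_equal.
    apply sum_n_ext. intros j. now rewrite im_scal_l.
Qed.

Theorem theorem3p2 :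
  forall (a b c : R) (k r : nat) (alpha : nat -> C),
    0 < a -> 0 < b -> 0 < c -> a <> b ->
    (0 < r)%nat ->
    (forall i : nat, (i < r)%nat -> alpha i <> RtoC 0) ->
    forall (x : R) (n : nat),
    analytic_at_0 (gen_fun (INR r - x) k a b c r alpha) ->
    analytic_at_0 (gen_fun x k a b c r (fun i : nat => / alpha i)%C) ->
    Mpoly r n (INR r - x) k a b c alpha =
    (RtoC (powerRZ (-1) (Z.of_nat r * (1 - Z.of_nat k) + Z.of_nat n))
     / Cprod alpha r
     * sum_n (G := C_AbelianMonoid)
         (fun j : nat =>
            RtoC (Binomial.C n j * (INR r * ln (a * b / c)) ^ (n - j))
            * Mpoly r j x k a b c (fun i : nat => / alpha i))
         n)%C.
Proof.
  intros a b c k r alpha Ha Hb Hc _ _ Halpha x n HF HG.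
  apply Taylor0_spec in HF, HG.
  assert (HP := Cprod_neq_0 alpha r Halpha).
  (* Here [K] is [(-1) ^ (r * k) * (-1) ^ r], [mu] is [INR r * ln (a * b / c)], and the left-hand
     function carries the factor [Cprod alpha r]. *)
  assert (E := Taylor_coeff_exp_mult_reflect _ _ _ _ _ _
    (is_Taylor0_scal _ _ (Cprod alpha r) HF) HG
    (fun t => gen_fun_reflect a b c k r alpha x t Ha Hb Hc Halpha) n).
  cbv beta in E.
  rewrite powerRZ_add, powerRZ_m1_sub, <- pow_powerRZ by lra.
  unfold Mpoly.
  (* [E] is the claim multiplied by the nonzero [Cprod alpha r]; it remains to divide. *)
  match type of E with _ = (?s * ?S)%C =>
    transitivity (s * S / Cprod alpha r)%C end.
  - rewrite <- E. field. exact HP.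
  - unfold Cdiv. ring.
Qed.
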